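(* Let $\epsilon,\delta\in(0,1)$, $\tilde\delta=\delta/2$ and $\tilde\epsilon=\sqrt{1+\epsilon}-1$. Let $\mathbf{S}_1,\dots,\mathbf{S}_k\in\mathbb{R}^{r\times n}$ be local sketching matrices, $\widehat{\mathbf{S}}=\mathrm{diag}(\mathbf{S}_1,\dots,\mathbf{S}_k)\in\mathbb{R}^{R\times N}$ with $R=rk$, let $\widehat{\mathbf{A}}=\widehat{\mathbf{S}}\mathbf{A}=[(\mathbf{S}_1\mathbf{A}_1)^\top\ \cdots\ (\mathbf{S}_k\mathbf{A}_k)^\top]^\top$ be the aggregated local sketches, and let $\mathbf{\Phi}\in\mathbb{R}^{\tilde R\times R}$ be a global sketching matrix which is applied to $\widehat{\mathbf{A}}$. If $\widehat{\mathbf{S}}$ (as a sketch of $\mathbf{A}$) and $\mathbf{\Phi}$ (as a sketch of $\widehat{\mathbf{A}}$) both satisfy the $\ell_2$-subspace embedding property with error probability $\tilde\delta$ and distortion $\tilde\epsilon$, then the hybrid sketching matrix $\widetilde{\mathbf{S}}=\mathbf{\Phi}\widehat{\mathbf{S}}\in\mathbb{R}^{\tilde R\times N}$ is an $\ell_2$-subspace embedding sketching matrix of $\mathbf{A}$ with error probability $\delta$ and distortion $\epsilon$.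
   Context: Setting: $\mathbf{A}\in\mathbb{R}^{N\times d}$ has full rank $d$, $N\gg d$; $k$ divides $N$, $n=N/k>d$, and $\mathbf{A}=[\mathbf{A}_1^\top\ \cdots\ \mathbf{A}_k^\top]^\top$ with $\mathbf{A}_i\in\mathbb{R}^{n\times d}$. Definition ($\ell_2$-subspace embedding property with error probability $\delta$ and distortion $\epsilon$): a (random) matrix $\mathbf{S}$ with $m$ columns has this property for a subspace $T\subseteq\mathbb{R}^m$ if, for a matrix $\mathbf{Q}$ whose columns form an orthonormal basis of $T$, $\|\mathbf{I}-(\mathbf{S}\mathbf{Q})^\top(\mathbf{S}\mathbf{Q})\|_2\leqslant\epsilon$ (spectral norm) holds with probability at least $1-\delta$. It has this property for (is an $\ell_2$-subspace embedding sketching matrix of) a matrix $\mathbf{M}$ if it has it for the column space $T=\mathrm{im}(\mathbf{M})$. Hybrid sketching: $k$ servers locally sketch their blocks $\mathbf{A}_i$ through $\mathbf{S}_i$, send $\mathbf{S}_i\mathbf{A}_i$ to the coordinator, who stacks them to obtain $\widehat{\mathbf{A}}$ and then computes $\widetilde{\mathbf{A}}=\mathbf{\Phi}\widehat{\mathbf{A}}$. *)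

(* Defs.v *)
From HB Require Import structures.
From mathcomp Require Import all_boot all_order all_algebra.
From mathcomp Require Import all_classical all_reals all_analysis.

Set Implicit Arguments.
Unset Strict Implicit.
Unset Printing Implicit Defensive.

Import Order.TTheory GRing.Theory Num.Theory.

Local Open Scope classical_set_scope.
Local Open Scope ring_scope.

Section Deterministic.
Variable R : realType.

(* The norm `|x| that MathComp-Analysis puts on matrices is the max norm. *)
Definition l2norm (m : nat) (x : 'cV[R]_m) : R :=
  Num.sqrt (\sum_(i < m) x i 0 ^+ 2).

(* Operator norm induced by the l2 norms; it is 0 for an empty matrix. *)
Definition spectral_norm (m p : nat) (B : 'M[R]_(m, p)) : R :=
  sup [set l2norm (B *m x) | x in [set x : 'cV[R]_p | l2norm x <= 1]].

Definition colspace (m p : nat) (M : 'M[R]_(m, p)) : {vspace 'cV[R]_m} :=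
  <<codom (fun j => col j M)>>%VS.

Definition orthonormal_basis (m p : nat) (T : {vspace 'cV[R]_m})
    (Q : 'M[R]_(m, p)) : Prop :=
  basis_of T (codom (fun j => col j Q)) /\ Q^T *m Q = 1%:M.

(* 'M_(\sum_(i < k) r, \sum_(i < k) n) is the library's type of k x k block
   matrices with blocks of size r x n; the dimensions equal r * k and n * k. *)
Definition block_diag (k r n : nat) (S : 'I_k -> 'M[R]_(r, n)) :
    'M[R]_(\sum_(i < k) r, \sum_(i < k) n) :=
  \mxblock_(i < k, j < k) (if i == j then S i else 0).

Definition aggregated_sketch (k r n d : nat) (S : 'I_k -> 'M[R]_(r, n))
    (A : 'M[R]_(\sum_(i < k) n, d)) : 'M[R]_(\sum_(i < k) r, d) :=
  \mxcol_(i < k) (S i *m submxcol A i).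

Lemma aggregated_sketchE (k r n d : nat) (S : 'I_k -> 'M[R]_(r, n))
    (A : 'M[R]_(\sum_(i < k) n, d)) :
  aggregated_sketch S A = block_diag S *m A.
Proof.
apply/mxcolP => i; rewrite mxcolK -submxcol_mul /block_diag mxblockEv mxcolK.
rewrite -{2}(submxcolK A) mul_mxrow_mxcol (bigD1 i) //= eqxx.
by rewrite big1 ?addr0 // => j; rewrite eq_sym => /negPf ->; rewrite mul0mx.
Qed.

End Deterministic.

Section Random.
Context (R : realType) (disp : measure_display) (Omega : measurableType disp).

Definition random_matrix (m p : nat) (M : Omega -> 'M[R]_(m, p)) : Prop :=
  forall i j, measurable_fun [set: Omega] (fun w => M w i j).

(* The subspace may itself be random (a fixed one is a constant function), in
   which case the probability is taken over the joint law of S and T. By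
   orthogonal invariance of the spectral norm, the event below does not depend
   on the choice of the orthonormal bases Q w; in particular no measurability
   of Q is needed. *)
Definition l2_embedding_subspace (P : probability Omega R) (l m : nat)
    (S : Omega -> 'M[R]_(l, m)) (T : Omega -> {vspace 'cV[R]_m})
    (delta eps : R) : Prop :=
  forall Q : (forall w, 'M[R]_(m, \dim (T w))),
    (forall w, orthonormal_basis (T w) (Q w)) ->
    ((1 - delta)%:E <=
     P [set w | (spectral_norm (1%:M - (S w *m Q w)^T *m (S w *m Q w))
                 <= eps)%R])%E.

Definition l2_embedding (P : probability Omega R) (l m p : nat)
    (S : Omega -> 'M[R]_(l, m)) (M : Omega -> 'M[R]_(m, p))
    (delta eps : R) : Prop :=
  l2_embedding_subspace P S (fun w => colspace (M w)) delta eps.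

End Random.

(* Main.v *)
(* The event in the embedding property does not involve the orthonormal basis:
   for Q an orthonormal basis of im(M), the symmetric matrix I - (SQ)^T(SQ) has
   spectral norm at most e iff | |Mx|^2 - |SMx|^2 | <= e |Mx|^2 for all x. The
   two hypotheses thus give |Shat A x|^2 within a factor 1 +- e' of |Ax|^2, and
   |Phi Shat A x|^2 within a factor 1 +- e' of |Shat A x|^2; as
   (1 + e')^2 = 1 + e and (1 - e')^2 >= 1 - e, a union bound concludes.
   The union bound needs the events to be measurable (P is unspecified
   elsewhere), which holds because it suffices to test rational vectors x. *)
Require Import Defs.
From HB Require Import structures.
From mathcomp Require Import all_boot all_order all_algebra.
From mathcomp Require Import all_classical all_reals all_analysis.
From mathcomp Require Import measurable_realfun ring lra.

Set Implicit Arguments.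
Unset Strict Implicit.
Unset Printing Implicit Defensive.

Import Order.TTheory GRing.Theory Num.Theory.
Import numFieldNormedType.Exports.

Local Open Scope classical_set_scope.
Local Open Scope ring_scope.

(** * Euclidean inner product and the spectral norm of symmetric matrices *)

Section InnerProduct.
Variable R : realType.

Definition dotp (m : nat) (x y : 'cV[R]_m) : R := (x^T *m y) 0 0.

Definition sqnorm (m : nat) (x : 'cV[R]_m) : R := dotp x x.

Lemma dotpE m (x y : 'cV[R]_m) : dotp x y = \sum_(i < m) x i 0 * y i 0.
Proof. by rewrite /dotp mxE; apply: eq_bigr => i _; rewrite mxE. Qed.

Lemma sqnormE m (x : 'cV[R]_m) : sqnorm x = \sum_(i < m) x i 0 ^+ 2.
Proof. by rewrite /sqnorm dotpE; apply: eq_bigr => i _; rewrite expr2. Qed.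

Lemma dotpC m (x y : 'cV[R]_m) : dotp x y = dotp y x.
Proof. by rewrite !dotpE; apply: eq_bigr => i _; rewrite mulrC. Qed.

Lemma dotpDl m (x y z : 'cV[R]_m) : dotp (x + y) z = dotp x z + dotp y z.
Proof. by rewrite /dotp linearD mulmxDl mxE. Qed.

Lemma dotpZl m a (x z : 'cV[R]_m) : dotp (a *: x) z = a * dotp x z.
Proof. by rewrite /dotp linearZ -scalemxAl mxE. Qed.

Lemma dotpDr m (x y z : 'cV[R]_m) : dotp x (y + z) = dotp x y + dotp x z.
Proof. by rewrite dotpC dotpDl !(dotpC x). Qed.

Lemma dotpZr m a (x z : 'cV[R]_m) : dotp x (a *: z) = a * dotp x z.
Proof. by rewrite dotpC dotpZl dotpC. Qed.

Lemma dotp_mulmxl m n (B : 'M[R]_(m, n)) x y :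
  dotp (B *m x) y = dotp x (B^T *m y).
Proof. by rewrite /dotp trmx_mul mulmxA. Qed.

Lemma sqnorm_ge0 m (x : 'cV[R]_m) : 0 <= sqnorm x.
Proof. by rewrite sqnormE sumr_ge0// => i _; exact: sqr_ge0. Qed.

Lemma sqnorm_eq0 m (x : 'cV[R]_m) : (sqnorm x == 0) = (x == 0).
Proof.
apply/eqP/eqP => [|->]; last by rewrite /sqnorm /dotp mulmx0 mxE.
rewrite sqnormE => /psumr_eq0P x0; apply/colP => i; rewrite mxE.
by apply/eqP; rewrite -sqrf_eq0 x0// => j _; exact: sqr_ge0.
Qed.

Lemma sqnormZ m a (x : 'cV[R]_m) : sqnorm (a *: x) = a ^+ 2 * sqnorm x.
Proof. by rewrite /sqnorm dotpZl dotpZr mulrA. Qed.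

Lemma l2norm_sqnorm m (x : 'cV[R]_m) : l2norm x = Num.sqrt (sqnorm x).
Proof. by rewrite /l2norm sqnormE. Qed.

Lemma sqnorm_l2norm m (x : 'cV[R]_m) : l2norm x ^+ 2 = sqnorm x.
Proof. by rewrite l2norm_sqnorm sqr_sqrtr ?sqnorm_ge0. Qed.

Lemma l2norm_ge0 m (x : 'cV[R]_m) : 0 <= l2norm x.
Proof. exact: sqrtr_ge0. Qed.

Lemma l2normZ m a (x : 'cV[R]_m) : l2norm (a *: x) = `|a| * l2norm x.
Proof. by rewrite !l2norm_sqnorm sqnormZ sqrtrM ?sqr_ge0// sqrtr_sqr. Qed.

Lemma l2norm_eq0 m (x : 'cV[R]_m) : (l2norm x == 0) = (x == 0).
Proof. by rewrite -sqrf_eq0 sqnorm_l2norm sqnorm_eq0. Qed.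

Lemma l2norm0 m : l2norm (0 : 'cV[R]_m) = 0.
Proof. by apply/eqP; rewrite l2norm_eq0. Qed.

Lemma cauchy_schwarz m (x y : 'cV[R]_m) : `|dotp x y| <= l2norm x * l2norm y.
Proof.
have [->|y0] := eqVneq y 0.
  by rewrite /dotp mulmx0 mxE normr0 mulr_ge0 ?l2norm_ge0.
have sy : 0 < sqnorm y by rewrite lt_def sqnorm_eq0 y0 sqnorm_ge0.
rewrite -ler_sqr ?nnegrE ?mulr_ge0 ?l2norm_ge0// exprMn !sqnorm_l2norm.
rewrite real_normK ?num_real// -(ler_pM2r sy).
(* This square expands to [sqnorm y * (sqnorm x * sqnorm y - dotp x y ^+ 2)], which is why the goal
   was multiplied by [sqnorm y]. *)
have := sqnorm_ge0 (sqnorm y *: x + (- dotp x y) *: y).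
rewrite {1}/sqnorm !(dotpDl, dotpDr, dotpZl, dotpZr) -!/(sqnorm _) (dotpC y x).
nra.
Qed.

(* The spectral norm is a supremum, hence junk unless the set is bounded. *)
Lemma spectral_norm_has_sup m p (B : 'M[R]_(m, p)) :
  has_sup [set l2norm (B *m x) | x in [set x : 'cV[R]_p | l2norm x <= 1]].
Proof.
split.
  by exists (l2norm (B *m 0)); exists 0 => //=; rewrite l2norm0 ler01.
(* The bound is the Frobenius norm: each entry of [B *m x] is the inner product of a row of [B] with
   [x], so Cauchy-Schwarz applies row by row. *)
exists (Num.sqrt (\sum_(i < m) sqnorm (row i B)^T)) => _ [x /= x1 <-].
rewrite l2norm_sqnorm ler_sqrt; last first.
  by apply: sumr_ge0 => i _; exact: sqnorm_ge0.
rewrite sqnormE; apply: ler_sum => i _.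
have -> : (B *m x) i 0 = dotp (row i B)^T x.
  by rewrite dotpE mxE; apply: eq_bigr => j _; rewrite !mxE.
rewrite -sqnorm_l2norm -real_normK ?num_real// ler_sqr ?nnegrE ?l2norm_ge0//.
by rewrite (le_trans (cauchy_schwarz _ _))// ler_piMr// l2norm_ge0.
Qed.

Lemma l2norm_mulmx_le m p (B : 'M[R]_(m, p)) x :
  l2norm (B *m x) <= spectral_norm B * l2norm x.
Proof.
have [->|x0] := eqVneq x 0.
  by rewrite mulmx0 !l2norm0 mulr0.
have lx : 0 < l2norm x by rewrite lt_def l2norm_eq0 x0 l2norm_ge0.
have normV : `|(l2norm x)^-1| = (l2norm x)^-1.
  by rewrite ger0_norm// invr_ge0 l2norm_ge0.
rewrite -ler_pdivrMr// -[leLHS]mulrC.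
have -> : (l2norm x)^-1 * l2norm (B *m x) = l2norm (B *m ((l2norm x)^-1 *: x)).
  by rewrite -scalemxAr l2normZ normV.
apply: sup_upper_bound; first exact: spectral_norm_has_sup.
exists ((l2norm x)^-1 *: x) => //=.
by rewrite l2normZ normV mulVf// gt_eqF.
Qed.

Lemma spectral_norm_le m p (B : 'M[R]_(m, p)) e :
  (forall x, l2norm x <= 1 -> l2norm (B *m x) <= e) -> spectral_norm B <= e.
Proof.
move=> Be; apply: ge_sup; first by have [] := spectral_norm_has_sup B.
by move=> _ [x /= x1 <-]; exact: Be.
Qed.

(** Cauchy-Schwarz gives the forward direction. The converse recovers the norm of [B *m x] from
    values of the quadratic form alone, so no eigenvalues are involved. *)
Lemma spectral_norm_sym_leP p (B : 'M[R]_p) e : 0 <= e -> B^T = B ->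
  spectral_norm B <= e <-> forall x, `|dotp x (B *m x)| <= e * sqnorm x.
Proof.
move=> e0 Bsym; split=> [Be x|Be].
  apply: (le_trans (cauchy_schwarz _ _)); rewrite -sqnorm_l2norm.
  rewrite mulrC expr2 mulrA ler_wpM2r ?l2norm_ge0//.
  by rewrite (le_trans (l2norm_mulmx_le _ _))// ler_wpM2r ?l2norm_ge0.
apply: spectral_norm_le => x x1; have [->//|z0] := eqVneq (l2norm (B *m x)) 0.
have z_gt0 : 0 < l2norm (B *m x) by rewrite lt_def z0 l2norm_ge0.
(* Polarization, with [y] the unit vector in the direction of [B *m x]. *)
set y := (l2norm (B *m x))^-1 *: (B *m x).
have y1 : sqnorm y = 1.
  by rewrite sqnormZ -sqnorm_l2norm -exprMn mulVf// expr1n.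
have yBx : dotp y (B *m x) = l2norm (B *m x).
  by rewrite dotpZl -/(sqnorm _) -sqnorm_l2norm expr2 mulrA mulVf// mul1r.
have xBy : dotp x (B *m y) = l2norm (B *m x).
  by rewrite dotpC dotp_mulmxl Bsym.
have sx1 : sqnorm x <= 1 by rewrite -sqnorm_l2norm expr_le1// l2norm_ge0.
clearbody y; have := Be (x + y); have := Be (x + (-1) *: y).
rewrite /sqnorm !mulmxDr -!scalemxAr !(dotpDl, dotpDr, dotpZl, dotpZr).
rewrite -!/(sqnorm _) yBx xBy y1 (dotpC y x).
rewrite !ler_norml => /andP[h1 h2] /andP[h3 h4].
(* With q the quadratic form of [B]: 4 |Bx| = q(x + y) - q(x - y) <= e (|x + y|^2 + |x - y|^2) = 2 e
   (|x|^2 + 1) <= 4 e. *)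
nra.
Qed.

End InnerProduct.

(** * Column spaces and orthonormal bases *)

Section Orthonormal.
Variable R : realType.

(** Seen as the image of a linear map, the column space inherits the membership and dimension
    results for [limg]. *)
Lemma colspaceE m p (M : 'M[R]_(m, p)) :
  colspace M = limg (linfun (fun y : 'cV[R]_p => M *m y)).
Proof.
apply/eqP; rewrite eqEsubv; apply/andP; split.
  apply/span_subvP => _ /codomP[j ->]; apply/memv_imgP.
  by exists (delta_mx j 0); rewrite ?memvf// lfunE /= colE.
apply/subvP => _ /memv_imgP[y _ ->]; rewrite lfunE /=.
have -> : M *m y = \sum_j y j 0 *: col j M.
  apply/colP => i; rewrite mxE summxE; apply: eq_bigr => j _.
  by rewrite !mxE mulrC.
by apply: memv_suml => j _; rewrite memvZ// memv_span// codom_f.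
Qed.

Lemma mem_colspaceP m p (M : 'M[R]_(m, p)) x :
  x \in colspace M <-> exists y, x = M *m y.
Proof.
rewrite colspaceE; split=> [/memv_imgP[y _ ->]|[y ->]].
  by exists y; rewrite lfunE.
by apply/memv_imgP; exists y; rewrite ?memvf// lfunE.
Qed.

(** Gram-Schmidt, by induction on the number of columns: while [p < \dim T], some vector of [T] lies
    outside the span of the columns found so far. *)
Lemma exists_orthonormal_columns m (T : {vspace 'cV[R]_m}) p :
  (p <= \dim T)%N ->
  exists2 Q : 'M[R]_(m, p), Q^T *m Q = 1%:M & (colspace Q <= T)%VS.
Proof.
elim: p => [_|p IHp pT].
  exists 0; first by apply/matrixP => -[].
  by apply/span_subvP => x /codomP[j _]; have := ltn_ord j.
have [Q Q1 QT] := IHp (ltnW pT).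
have /subvPn[v vT vQ] : ~~ (T <= colspace Q)%VS.
  apply: contraTN pT => /dimvS; rewrite -leqNgt => /leq_trans; apply.
  by rewrite (leq_trans (dim_span _))// size_codom card_ord.
(* Since [Q^T *m Q = 1%:M], [Q *m Q^T] is the orthogonal projection onto the column space of [Q], so
   [u] is the component of [v] orthogonal to it. *)
set u := v - Q *m (Q^T *m v).
have u0 : l2norm u != 0.
  rewrite l2norm_eq0; apply: contra vQ; rewrite subr_eq0 => /eqP ->.
  by apply/mem_colspaceP; exists (Q^T *m v).
have Qu : Q^T *m u = 0 by rewrite mulmxBr (mulmxA Q^T Q) Q1 mul1mx subrr.
have uT : u \in T.
  rewrite memvB//; apply: (subvP QT); apply/mem_colspaceP.
  by exists (Q^T *m v).
pose u' := (l2norm u)^-1 *: u.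
have Qu' : Q^T *m u' = 0 by rewrite -scalemxAr Qu scaler0.
have u'1 : u'^T *m u' = 1%:M.
  rewrite [LHS]mx11_scalar; congr (_%:M); rewrite -[LHS]/(sqnorm u') sqnormZ.
  by rewrite -sqnorm_l2norm -exprMn mulVf// expr1n.
rewrite -[p.+1]/(1 + p)%N; exists (row_mx u' Q).
  rewrite tr_row_mx mul_col_row u'1 Qu' Q1 -[u'^T *m Q]trmxK trmx_mul trmxK Qu'.
  by rewrite trmx0 -scalar_mx_block.
apply/subvP => x /mem_colspaceP[y ->].
rewrite -[y](@vsubmxK _ 1) mul_row_col memvD//.
  by rewrite [usubmx y]mx11_scalar mul_mx_scalar !memvZ.
by apply: (subvP QT); apply/mem_colspaceP; exists (dsubmx y).
Qed.

(** The embedding property quantifies over all orthonormal bases; existence of one allows a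
    probability bound to be extracted from it. *)
Lemma exists_orthonormal_basis m (T : {vspace 'cV[R]_m}) :
  exists Q : 'M[R]_(m, \dim T), orthonormal_basis T Q.
Proof.
have [Q Q1 QT] := exists_orthonormal_columns (leqnn (\dim T)).
exists Q; split=> //; rewrite basisEdim size_codom card_ord leqnn andbT.
suff: (colspace Q == T)%VS by rewrite eqEsubv => /andP[].
rewrite eqEdim QT colspaceE.
(* [Q^T] is a left inverse of [Q], so the image of [Q] has dimension [\dim T] and its inclusion in
   [T] is an equality. *)
have Q_inj : lker (linfun (fun y : 'cV[R]_(\dim T) => Q *m y)) == 0%VS.
  apply/lker0P => x y; rewrite !lfunE => /(congr1 (mulmx Q^T)) /=.
  by rewrite !mulmxA Q1 !mul1mx.
by rewrite limg_dim_eq ?(eqP Q_inj) ?capv0// dimvf /dim /= muln1.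
Qed.

Lemma orthonormal_basis_memP m p (T : {vspace 'cV[R]_m}) (Q : 'M[R]_(m, p)) x :
  orthonormal_basis T Q -> x \in T <-> exists y, x = Q *m y.
Proof. by move=> [/span_basis <- _]; exact: mem_colspaceP. Qed.

(** [Q] maps isometrically onto [T], and the quadratic form of the symmetric matrix I - (SQ)^T(SQ)
    at y is |Qy|^2 - |SQy|^2. The right-hand side is free of [Q]. *)
Lemma spectral_norm_embeddingP l m p (S : 'M[R]_(l, m)) (T : {vspace 'cV[R]_m})
    (Q : 'M[R]_(m, p)) e : 0 <= e -> orthonormal_basis T Q ->
  spectral_norm (1%:M - (S *m Q)^T *m (S *m Q)) <= e <->
  forall x, x \in T -> `|sqnorm x - sqnorm (S *m x)| <= e * sqnorm x.
Proof.
move=> e0 QT; have [_ Q1] := QT.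
have sQ y : sqnorm (Q *m y) = sqnorm y.
  by rewrite /sqnorm dotp_mulmxl mulmxA Q1 mul1mx.
have dQ y : dotp y ((1%:M - (S *m Q)^T *m (S *m Q)) *m y) =
    sqnorm (Q *m y) - sqnorm (S *m (Q *m y)).
  rewrite sQ mulmxBl mul1mx -scaleN1r dotpDr dotpZr mulN1r; congr (_ - _).
  by rewrite -mulmxA -dotp_mulmxl -mulmxA.
rewrite spectral_norm_sym_leP//; last first.
  by rewrite linearB /= trmx1 trmx_mul trmxK.
split=> [Be _ /(orthonormal_basis_memP _ QT)[y ->]|ST y].
  by rewrite -dQ sQ.
rewrite dQ -[X in e * X]sQ; apply: ST.
by apply/(orthonormal_basis_memP _ QT); exists y.
Qed.

End Orthonormal.

(** * Reduction to countably many test vectors *)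

Section RationalTest.
Variable R : realType.

(** A neighbourhood of a matrix contains a product of neighbourhoods of its entries, and each of
    these contains a rational. *)
Lemma nbhs_rat_mx m n (x : 'M[R]_(m, n)) (A : set 'M[R]_(m, n)) :
  nbhs x A -> exists q : 'M[rat]_(m, n), A (map_mx ratr q).
Proof.
move=> [B xB BA].
have /(_ _ _)/cid qB i j : exists q : rat, B i j (ratr q).
  have [|b [Bb [q _ qE]]] :=
      @dense_rat R (B i j)^°%classic _ (open_interior _).
    by exists (x i j); exact: xB.
  by exists q; rewrite qE; exact: interior_subset.
exists (\matrix_(i, j) projT1 (qB i j)).
by apply: BA => i j; rewrite !mxE; exact: (projT2 (qB i j)).
Qed.

Lemma sqnorm_mulmx_continuous m p (M : 'M[R]_(m, p)) :
  continuous (fun x : 'cV[R]_p => sqnorm (M *m x)).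
Proof.
have -> : (fun x : 'cV[R]_p => sqnorm (M *m x)) =
    fun x => \sum_i (\sum_j M i j * x j 0) ^+ 2.
  by apply/funext => x; rewrite sqnormE; apply: eq_bigr => i _; rewrite mxE.
have lin_cont i : continuous (fun x : 'cV[R]_p => \sum_j M i j * x j 0).
  apply: continuous_big => [|j _ x]; first exact: add_continuous.
  by apply: continuousM; [exact: cst_continuous|exact: coord_continuous].
apply: continuous_big => [|i _ x]; first exact: add_continuous.
exact: (continuous_cvg _ (@exprn_continuous R 2 _) (lin_cont i x)).
Qed.

(** The vectors violating the inequality form an open set, the preimage of the negative reals under
    a continuous map; if nonempty, it contains a rational vector. *)
Lemma sqnorm_distortion_ratP l m p (M : 'M[R]_(m, p)) (N : 'M[R]_(l, p)) e :
  (forall x, `|sqnorm (M *m x) - sqnorm (N *m x)| <= e * sqnorm (M *m x)) <->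
  forall q : 'cV[rat]_p, let x := map_mx ratr q in
    `|sqnorm (M *m x) - sqnorm (N *m x)| <= e * sqnorm (M *m x).
Proof.
split=> [MN q|MN x]; first exact: MN.
rewrite -subr_ge0.
pose f (x : 'cV[R]_p) :=
  e * sqnorm (M *m x) - `|sqnorm (M *m x) - sqnorm (N *m x)|.
have fc : continuous f.
  have Mc := @sqnorm_mulmx_continuous _ _ M.
  have Nc := @sqnorm_mulmx_continuous _ _ N.
  move=> z.
  exact: (cvgB (cvgM (cvg_cst e) (Mc z)) (cvg_norm (cvgB (Mc z) (Nc z)))).
apply: contrapT => /negP; rewrite -ltNge => fx.
have [|q /= fq] := @nbhs_rat_mx p 1 x (f @^-1` [set y | y < 0]).
  by apply: fc; apply: open_nbhs_nbhs; split; first exact: open_lt.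
by move: fq; rewrite /f ltNge subr_ge0 => /negP; apply; exact: MN.
Qed.

End RationalTest.

(** * Measurability, basis-free embedding events and the union bound *)

Section RandomMatrix.
Context (R : realType) (disp : measure_display) (Omega : measurableType disp).

Lemma random_matrix_cst m p (M : 'M[R]_(m, p)) :
  random_matrix (fun _ : Omega => M).
Proof. by move=> i j; exact: measurable_cst. Qed.

Lemma random_matrix_mul m n p (M : Omega -> 'M[R]_(m, n))
    (N : Omega -> 'M[R]_(n, p)) :
  random_matrix M -> random_matrix N -> random_matrix (fun w => M w *m N w).
Proof.
move=> rM rN i j; under eq_fun do rewrite mxE.
by apply: measurable_sum => s; exact: measurable_funM.
Qed.

Lemma random_matrix_block_diag k r n (S : 'I_k -> Omega -> 'M[R]_(r, n)) :
  (forall i, random_matrix (S i)) ->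
  random_matrix (fun w => block_diag (fun i => S i w)).
Proof.
move=> rS i j; under eq_fun do rewrite mxE.
case: eqP => _; first exact: rS.
by under eq_fun do rewrite mxE; exact: measurable_cst.
Qed.

Lemma random_matrix_sqnorm m p (M : Omega -> 'M[R]_(m, p)) x :
  random_matrix M -> measurable_fun [set: Omega] (fun w => sqnorm (M w *m x)).
Proof.
move=> rM; under eq_fun do rewrite sqnormE.
apply: measurable_sum => i; apply: measurable_funX.
exact: (random_matrix_mul rM (random_matrix_cst x)).
Qed.

(** Vectors of the column space are parametrised as [M w *m x], which avoids any choice of basis
    depending on [w]. *)
Definition distortion_event l m p (S : Omega -> 'M[R]_(l, m))
    (M : Omega -> 'M[R]_(m, p)) e : set Omega :=
  [set w | forall x, `|sqnorm (M w *m x) - sqnorm (S w *m M w *m x)|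
                     <= e * sqnorm (M w *m x)].

Lemma measurable_distortion_event l m p (S : Omega -> 'M[R]_(l, m))
    (M : Omega -> 'M[R]_(m, p)) e :
  random_matrix S -> random_matrix M -> measurable (distortion_event S M e).
Proof.
move=> rS rM; have rSM := random_matrix_mul rS rM.
(* Rational vectors are enumerated by [unpickle]; an index that decodes to no vector imposes no
   condition. *)
rewrite (_ : distortion_event S M e = \bigcap_(k : nat)
    [set w | if unpickle k is Some q then
       let x := map_mx ratr (q : 'cV[rat]_p) in
       `|sqnorm (M w *m x) - sqnorm (S w *m M w *m x)| <= e * sqnorm (M w *m x)
     else True]).
  apply: bigcapT_measurable => k; case: unpickle => [q|]; last first.
    exact: measurableT.
  rewrite -[X in measurable X]setTI; apply: measurable_fun_le => //.
    apply: measurableT_comp => //; apply: measurable_funB;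
      exact: random_matrix_sqnorm.
  by apply: measurable_funM => //; exact: random_matrix_sqnorm.
apply/seteqP; split=> w /=.
  by move=> /sqnorm_distortion_ratP Mw k _ /=; case: unpickle.
move=> Mw; apply/sqnorm_distortion_ratP => q.
by have := Mw (pickle q) I; rewrite /= pickleK.
Qed.

(** Whatever family of bases is chosen, the spectral norm event is the same set as
    [distortion_event]. *)
Lemma l2_embeddingE (P : probability Omega R) l m p (S : Omega -> 'M[R]_(l, m))
    (M : Omega -> 'M[R]_(m, p)) delta e : 0 <= e ->
  l2_embedding P S M delta e <->
  ((1 - delta)%:E <= P (distortion_event S M e))%E.
Proof.
move=> e0; have eventE (Q : forall w, 'M[R]_(m, \dim (colspace (M w)))) :
    (forall w, orthonormal_basis (colspace (M w)) (Q w)) ->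
    [set w | (spectral_norm (1%:M - (S w *m Q w)^T *m (S w *m Q w)) <= e)%R] =
    distortion_event S M e.
  move=> QM; apply/seteqP; split=> w /=.
    move=> /(spectral_norm_embeddingP _ e0 (QM w)) Se x; rewrite -mulmxA.
    by apply: Se; apply/mem_colspaceP; exists x.
  move=> Se; apply/(spectral_norm_embeddingP _ e0 (QM w)).
  move=> _ /mem_colspaceP[x ->].
  by rewrite mulmxA.
split=> [|PS Q QM]; last by rewrite eventE.
(* The choice of a basis for each [w] is arbitrary and may be non-measurable in [w]. *)
have /(_ _)/cid Q w := exists_orthonormal_basis (colspace (M w)).
move=> /(_ (fun w => projT1 (Q w)) (fun w => projT2 (Q w))).
by rewrite eventE// => w; exact: (projT2 (Q w)).
Qed.

(** Union bound on the complements, carried over to real numbers since probabilities are finite. *)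
Lemma probability_setI_ge (P : probability Omega R) (E F : set Omega) a b :
  measurable E -> measurable F ->
  ((1 - a)%:E <= P E)%E -> ((1 - b)%:E <= P F)%E ->
  ((1 - (a + b))%:E <= P (E `&` F))%E.
Proof.
move=> mE mF.
have PE G : measurable G -> P G = (fine (P G))%:E.
  by move=> mG; rewrite fineK// fin_num_measure.
have : (P (~` (E `&` F)) <= P (~` E) + P (~` F))%E.
  by rewrite setCI; apply: measureU2; exact: measurableC.
rewrite !probability_setC//; last exact: measurableI.
rewrite (PE E)// (PE F)// (PE (E `&` F)); last exact: measurableI.
rewrite -!EFinB -EFinD !lee_fin; lra.
Qed.

End RandomMatrix.

Theorem theorem3 (R : realType) (disp : measure_display)
    (Omega : measurableType disp) (P : probability Omega R)
    (k n d r Rt : nat) (k_gt0 : (0 < k)%N) (n_gt_d : (d < n)%N)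
    (A : 'M[R]_(\sum_(i < k) n, d)) (A_full : \rank A = d)
    (eps delta : R)
    (eps_gt0 : 0 < eps) (eps_lt1 : eps < 1)
    (delta_gt0 : 0 < delta) (delta_lt1 : delta < 1)
    (S : 'I_k -> Omega -> 'M[R]_(r, n))
    (Phi : Omega -> 'M[R]_(Rt, \sum_(i < k) r))
    (S_random : forall i, random_matrix (S i))
    (Phi_random : random_matrix Phi) :
  let Shat := fun w => block_diag (fun i => S i w) in
  let Ahat := fun w => aggregated_sketch (fun i => S i w) A in
  let delta' := delta / 2 in
  let eps' := Num.sqrt (1 + eps) - 1 in
  l2_embedding P Shat (fun=> A) delta' eps' ->
  l2_embedding P Phi Ahat delta' eps' ->
  l2_embedding P (fun w => Phi w *m Shat w) (fun=> A) delta eps.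
Proof.
move=> Shat Ahat delta' eps'.
have AhatE : Ahat = fun w => Shat w *m A.
  by apply/funext => w; exact: aggregated_sketchE.
have rShat : random_matrix Shat by exact: random_matrix_block_diag.
have rA : random_matrix (fun _ : Omega => A) by exact: random_matrix_cst.
have rAhat : random_matrix Ahat by rewrite AhatE; exact: random_matrix_mul.
have eps'2 : (1 + eps') ^+ 2 = 1 + eps.
  by rewrite addrCA subrr addr0 sqr_sqrtr// addr_ge0 ?ltW.
have eps'_ge0 : 0 <= eps'.
  by rewrite subr_ge0 -[leLHS]sqrtr1 ler_wsqrtr// lerDl ltW.
have eps'_le1 : eps' <= 1 by nra.
have mI := measurableI _ _ (measurable_distortion_event eps' rShat rA)
  (measurable_distortion_event eps' Phi_random rAhat).
rewrite !l2_embeddingE ?(ltW eps_gt0)// => PS PPhi.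
have -> : delta = delta' + delta' by rewrite /delta'; lra.
have := probability_setI_ge (measurable_distortion_event eps' rShat rA)
  (measurable_distortion_event eps' Phi_random rAhat) PS PPhi.
move=> /le_trans; apply; apply: le_measure; rewrite ?inE//.
  by apply: measurable_distortion_event => //; exact: random_matrix_mul.
move=> w [/= hS hPhi] x.
have := hS x; have := hPhi x; rewrite AhatE -!mulmxA.
(* Only real arithmetic remains, on the squared norms [a], [b], [c] before sketching, after [Shat]
   and after [Phi]. *)
move: (sqnorm _) (sqnorm_ge0 (A *m x)) => a a0.
move: (sqnorm _) (sqnorm_ge0 (Shat w *m (A *m x))) => b b0.
move: (sqnorm _) (sqnorm_ge0 (Phi w *m (Shat w *m (A *m x)))) => c c0.
rewrite !ler_norml => /andP[h1 h2] /andP[h3 h4].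
(* These products bound [eps' * b] in terms of [a]. Chaining gives c <= (1 + eps')^2 a = (1 + eps) a
   and c >= (1 - 2 eps' - eps'^2) a = (1 - eps) a. *)
have := ler_wpM2l eps'_ge0 h3; have := ler_wpM2l eps'_ge0 h4.
nra.
Qed.
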